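(* For $m\ge 1$ let $L_m$ be the loopy star with $m$ leaves (so $m+1$ vertices). In the Strings-and-Coins game on $L_m$ under optimal play: if the number of vertices $m+1$ is even, Player 1 wins by exactly two points; if $m+1$ is odd, Player 2 wins by exactly three points.
   Context: Strings-and-Coins game: played on a finite multigraph (loops and parallel edges allowed) in which every vertex initially has at least one incident edge. Two players, Player 1 moving first, alternately remove one edge (a loop counts as one edge). Whenever a removal leaves one or more vertices with no incident edges, the mover earns one point for each such vertex and must move again, provided edges remain. The game ends when no edges remain; a player wins if they have more points. Optimal play means each player maximizes (own final score) minus (opponent's final score). ''Player X wins by $k$ points'' means that under optimal play the final score of X exceeds the opponent's by exactly $k$. The loopy star $L_m$ has a central vertex $c$ (with no loop) and $m$ outer vertices $v_1,\dots,v_m$; for each $i$ there is one edge $cv_i$ and one loop at $v_i$, and there are no other edges. *)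

(* Defs.v *)
From mathcomp Require Import all_boot all_order all_algebra.

Set Implicit Arguments.
Unset Strict Implicit.
Unset Printing Implicit Defensive.

(* The pair [ends e] is read as unordered ([incident] is symmetric in it); a
   loop is an edge with equal ends, and [ends] need not be injective. *)
Record multigraph := Multigraph {
  vertex : finType;
  edge : finType;
  ends : edge -> vertex * vertex
}.

Definition incident (G : multigraph) (e : edge G) (v : vertex G) : bool :=
  (v == (ends e).1) || (v == (ends e).2).

Definition isolated (G : multigraph) (S : {set edge G}) (v : vertex G) : bool :=
  [forall e in S, ~~ incident e v].

Definition newly_isolated (G : multigraph) (S : {set edge G}) (e : edge G) :
    {set vertex G} :=
  [set v | ~~ isolated S v & isolated (S :\ e) v].

Inductive player := Player1 | Player2.

Definition opponent (X : player) : player :=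
  if X is Player1 then Player2 else Player1.

Definition scores : Type := nat * nat.

Definition score (r : scores) (X : player) : nat :=
  if X is Player1 then r.1 else r.2.

Definition credit (r : scores) (X : player) (g : nat) : scores :=
  if X is Player1 then (r.1 + g, r.2) else (r.1, r.2 + g).

Definition margin (r : scores) (X : player) : int :=
  ((score r X)%:Z - (score r (opponent X))%:Z)%R.

Record position (G : multigraph) := Position {
  remaining : {set edge G};
  mover : player;
  current : scores
}.

Definition start (G : multigraph) : position G :=
  Position [set: edge G] Player1 (0, 0).

Definition move (G : multigraph) (p : position G) (e : edge G) : position G :=
  let g := #|newly_isolated (remaining p) e| in
  Position (remaining p :\ e)
           (if 0 < g then mover p else opponent (mover p))
           (credit (current p) (mover p) g).

(* [optimal_in n p r]: [r] is a final score reached from [p] by [n] further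
   moves of optimal play, i.e. the mover removes an edge after which optimal
   play ends in [r], and no legal move followed by optimal play gives the mover
   a larger final margin.  Every move removes exactly one edge, so [n] is always
   the number of remaining edges. *)
Fixpoint optimal_in (G : multigraph) (n : nat) (p : position G) (r : scores) :
    Prop :=
  if n is n'.+1 then
    exists e : edge G,
      [/\ e \in remaining p,
          optimal_in n' (move p e) r
        & forall (e' : edge G) (r' : scores),
            e' \in remaining p -> optimal_in n' (move p e') r' ->
            (margin r' (mover p) <= margin r (mover p))%R]
  else r = current p.

Definition optimal_outcome (G : multigraph) (p : position G) (r : scores) :
    Prop :=
  optimal_in #|remaining p| p r.

Definition wins_by (G : multigraph) (X : player) (k : nat) : Prop :=
  (exists r, optimal_outcome (start G) r) /\
  (forall r, optimal_outcome (start G) r ->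
     score r X = score r (opponent X) + k).

(* [None] is the centre c and [Some i] the outer vertex v_i; the edge [inl i]
   joins c to v_i and [inr i] is the loop at v_i. *)
Definition loopy_star (m : nat) : multigraph :=
  @Multigraph (option 'I_m) ('I_m + 'I_m)%type
    (fun e => match e with
              | inl i => (None, Some i)
              | inr i => (Some i, Some i)
              end).

Lemma loopy_star_no_isolated (m : nat) (v : vertex (loopy_star m)) :
  0 < m -> ~~ isolated [set: edge (loopy_star m)] v.
Proof.
move=> m0; rewrite negb_forall.
apply/existsP; case: v => [i|].
  by exists (inr i); rewrite negb_imply in_setT negbK /incident eqxx.
by exists (inl (Ordinal m0)); rewrite negb_imply in_setT negbK.
Qed.

(* Main.v *)
Require Import Defs.
From mathcomp Require Import all_boot all_order all_algebra.
From mathcomp Require Import zify.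

Set Implicit Arguments.
Unset Strict Implicit.
Unset Printing Implicit Defensive.

Import GRing.Theory Num.Theory.

(** Call a leaf full if both of its edges remain, strung if only the edge to
    the centre remains, looped if only its loop remains.  With [a] full, [b]
    strung and [c] looped leaves, the optimal future margin of the player to
    move is [b + c + t], where [t] is [2] if [a] is odd, [-3] if [a] is positive
    and even, and if [a = 0] then [t] is [1] or [0] according as the centre
    still has an edge or not.  Taking a looped or strung leaf keeps this value,
    and when only full leaves remain, cutting one off the centre does. *)

(** * Values of positions in an arbitrary multigraph *)

Section Value.

Variable G : multigraph.
Implicit Types (V : {set edge G} -> int) (S : {set edge G}).

(** Future margin of the mover who takes [e], if [V] is that of whoever moves next: the sign changes
    exactly when the turn passes. *)
Definition worth V S (e : edge G) : int :=
  let g := #|newly_isolated S e| in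
  (g%:Z + if (0 < g)%N then V (S :\ e) else - V (S :\ e))%R.

(** The Bellman equation of the game, its maximum split into an upper bound and attainment. Points
    already scored only shift the margin, so [V] depends on the edge set alone. *)
Definition minimax_value V : Prop :=
  [/\ V set0 = 0%R,
      forall S e, e \in S -> (worth V S e <= V S)%R
    & forall S, S != set0 -> exists2 e, e \in S & worth V S e = V S].

Lemma margin_opponent r X : margin r (opponent X) = (- margin r X)%R.
Proof. by case: X; rewrite /margin /= opprB. Qed.

Lemma margin_credit r X g : margin (credit r X g) X = (margin r X + g%:Z)%R.
Proof. by case: X; rewrite /margin /=; lia. Qed.

Lemma margin_move V (p : position G) e r :
  (margin r (mover (move p e)) = margin (current (move p e)) (mover (move p e))
                                 + V (remaining (move p e)))%R ->
  (margin r (mover p) = margin (current p) (mover p)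
                        + worth V (remaining p) e)%R.
Proof.
rewrite /worth /=; case: ifP => g_gt0.
  by rewrite margin_credit => ->; rewrite addrA.
rewrite !margin_opponent margin_credit; lia.
Qed.

(** Induction on the number of edges. An edge attaining [V] followed by optimal play gives
    existence. *)
Lemma minimax_value_optimal V n (p : position G) :
    minimax_value V -> #|remaining p| = n ->
  (exists r, optimal_in n p r) /\
  (forall r, optimal_in n p r ->
     margin r (mover p) =
       (margin (current p) (mover p) + V (remaining p))%R).
Proof.
case=> V0 Vmax Vatt; elim: n p => [|n IHn] p.
  move/eqP; rewrite cards_eq0 => /eqP S0.
  by split=> [|r ->]; [exists (current p) | rewrite S0 V0 addr0].
move=> cardS.
have cardM e : e \in remaining p -> #|remaining (move p e)| = n.
  by move=> eS; move: cardS; rewrite (cardsD1 e) eS => -[].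
have marginM e r : e \in remaining p -> optimal_in n (move p e) r ->
    margin r (mover p) = (margin (current p) (mover p)
                          + worth V (remaining p) e)%R.
  by move=> eS /(proj2 (IHn _ (cardM e eS))) /margin_move.
have Sn0 : remaining p != set0 by rewrite -card_gt0 cardS.
have [e eS eV] := Vatt _ Sn0.
have [[r opt_r] _] := IHn _ (cardM e eS).
split.
  exists r, e; split=> // e' r' e'S opt_r'.
  by rewrite (marginM e r) // (marginM e' r') // eV lerD2l Vmax.
(* Optimality of [r'] against the attaining edge [e] bounds its margin from below; [Vmax] bounds it
   from above. *)
move=> r' [e' [e'S opt_r' /(_ e r eS opt_r)]].
rewrite (marginM e r) // (marginM e' r') // eV.
move: (Vmax _ _ e'S); lia.
Qed.

(** A vertex off [e] keeps all its edges, and an end of [e] is not isolated while [e] remains. *)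
Lemma newly_isolatedE S e : e \in S ->
  newly_isolated S e = [set v | incident e v & isolated (S :\ e) v].
Proof.
move=> eS; apply/setP=> v; rewrite !inE.
case isoD: (isolated (S :\ e) v); rewrite ?andbF // !andbT.
apply/idP/idP => [|ev]; last first.
  by apply/negP=> /forall_inP /(_ e eS); rewrite ev.
apply: contraR => ev; apply/forall_inP=> f fS.
have [->//|fe] := eqVneq f e.
by move/forall_inP: isoD; apply; rewrite !inE fe.
Qed.

End Value.

(** * Leaf types and points scored in the loopy star *)

Section LoopyStar.

Variable m : nat.
Implicit Types (S : {set edge (loopy_star m)}) (i : 'I_m).

Definition full S : {set 'I_m} := [set i | (inl i \in S) && (inr i \in S)].
Definition strung S : {set 'I_m} := [set i | (inl i \in S) && (inr i \notin S)].
Definition looped S : {set 'I_m} := [set i | (inl i \notin S) && (inr i \in S)].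

Definition leaf_value (a b c : nat) : int :=
  (b%:Z + c%:Z +
   if a == 0%N then (0 < b)%N%:Z else if odd a then 2%:Z else - 3%:Z)%R.

Definition star_value S : int := leaf_value #|full S| #|strung S| #|looped S|.

Lemma isolated_leaf S i :
  isolated S (Some i : vertex (loopy_star m)) =
    (inl i \notin S) && (inr i \notin S).
Proof.
apply/forall_inP/andP => [iso|[lS rS] [j|j] jS].
- by split; apply/negP=> /iso; rewrite /incident /= !eqE /= eqxx.
- by apply: contra lS; rewrite /incident /= => /eqP[->].
- by apply: contra rS; rewrite /incident /= orbb => /eqP[->].
Qed.

Lemma isolated_centre S :
  isolated S (None : vertex (loopy_star m)) = (#|full S| + #|strung S| == 0).
Proof.
rewrite addn_eq0 !cards_eq0; apply/forall_inP/andP => [iso|[/eqP a0 /eqP b0]].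
  by split; apply/eqP/setP=> i; rewrite !inE; apply/negP=> /andP[/iso].
move=> [j|j] jS //; move/setP/(_ j): a0; move/setP/(_ j): b0.
by rewrite !inE jS /=; case: (_ \in _).
Qed.

Lemma card_newly_isolated_loop S i : inr i \in S ->
  #|newly_isolated S (inr i : edge (loopy_star m))| = (inl i \notin S).
Proof.
move=> iS; rewrite newly_isolatedE //.
case lS: (inl i \in S).
  apply/eqP; rewrite cards_eq0; apply/eqP/setP=> v; rewrite !inE.
  apply/negP=> /andP[]; rewrite /incident /= orbb => /eqP->.
  by rewrite isolated_leaf !inE lS.
apply/eqP/cards1P; exists (Some i); apply/setP=> v; rewrite !inE.
rewrite /incident /= orbb; case: eqP => //= ->.
by rewrite isolated_leaf !inE lS eqxx.
Qed.

(** The summands belong to the two ends of the string: the centre, isolated when no string is left,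
    and the leaf, isolated when its loop is already gone. *)
Lemma card_newly_isolated_string S i : inl i \in S ->
  #|newly_isolated S (inl i : edge (loopy_star m))| =
    (#|full (S :\ inl i)| + #|strung (S :\ inl i)| == 0) + (inr i \notin S).
Proof.
move=> iS; rewrite newly_isolatedE // (cardsD1 None) inE /= isolated_centre.
congr (_ + _).
rewrite (cardsD1 (Some i)) !inE /= /incident /= eqxx isolated_leaf !inE eqxx /=.
rewrite -[RHS]addn0; congr (_ + _).
apply/eqP; rewrite cards_eq0; apply/eqP/setP=> v; rewrite !inE.
by case: (v =P Some i) => //= _; case: (v == None).
Qed.

(** * Effect of the four kinds of move, and the resulting minimax equation *)

Lemma cards_string_full S i : i \in full S ->
  [/\ #|full S| = #|full (S :\ inl i)|.+1,
      #|strung (S :\ inl i)| = #|strung S|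
    & #|looped (S :\ inl i)| = #|looped S|.+1].
Proof.
move=> iF; move: (iF); rewrite inE => /andP[lS rS]; split.
- rewrite (cardsD1 i) iF; congr _.+1; apply: eq_card => j.
  by rewrite !inE (inj_eq inl_inj); case: (j == i).
- apply: eq_card => j; rewrite !inE (inj_eq inl_inj).
  by case: (j =P i) => // ->; rewrite /= rS andbF.
- rewrite (cardsD1 i (looped (S :\ inl i))) !inE eqxx rS /=.
  congr _.+1; apply: eq_card => j; rewrite !inE (inj_eq inl_inj).
  by case: (j =P i) => // ->; rewrite /= lS.
Qed.

Lemma cards_string_strung S i : i \in strung S ->
  [/\ #|full (S :\ inl i)| = #|full S|,
      #|strung S| = #|strung (S :\ inl i)|.+1
    & #|looped (S :\ inl i)| = #|looped S|].
Proof.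
move=> iF; move: (iF); rewrite inE => /andP[lS rS]; split.
- apply: eq_card => j; rewrite !inE (inj_eq inl_inj).
  by case: (j =P i) => // ->; rewrite /= (negPf rS) andbF.
- rewrite (cardsD1 i) iF; congr _.+1; apply: eq_card => j.
  by rewrite !inE (inj_eq inl_inj); case: (j == i).
- apply: eq_card => j; rewrite !inE (inj_eq inl_inj).
  by case: (j =P i) => // ->; rewrite /= (negPf rS) andbF.
Qed.

Lemma cards_loop_full S i : i \in full S ->
  [/\ #|full S| = #|full (S :\ inr i)|.+1,
      #|strung (S :\ inr i)| = #|strung S|.+1
    & #|looped (S :\ inr i)| = #|looped S|].
Proof.
move=> iF; move: (iF); rewrite inE => /andP[lS rS]; split.
- rewrite (cardsD1 i) iF; congr _.+1; apply: eq_card => j.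
  by rewrite !inE (inj_eq inr_inj); case: (j == i); rewrite ?andbF.
- rewrite (cardsD1 i (strung (S :\ inr i))) !inE eqxx lS /=.
  congr _.+1; apply: eq_card => j; rewrite !inE (inj_eq inr_inj).
  by case: (j =P i) => // ->; rewrite /= rS andbF.
- apply: eq_card => j; rewrite !inE (inj_eq inr_inj).
  by case: (j =P i) => // ->; rewrite /= lS.
Qed.

Lemma cards_loop_looped S i : i \in looped S ->
  [/\ #|full (S :\ inr i)| = #|full S|,
      #|strung (S :\ inr i)| = #|strung S|
    & #|looped S| = #|looped (S :\ inr i)|.+1].
Proof.
move=> iF; move: (iF); rewrite inE => /andP[lS rS]; split.
- apply: eq_card => j; rewrite !inE (inj_eq inr_inj).
  by case: (j =P i) => // ->; rewrite /= (negPf lS).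
- apply: eq_card => j; rewrite !inE (inj_eq inr_inj).
  by case: (j =P i) => // ->; rewrite /= (negPf lS).
- rewrite (cardsD1 i) iF; congr _.+1; apply: eq_card => j.
  by rewrite !inE (inj_eq inr_inj); case: (j == i); rewrite ?andbF.
Qed.

(** The loop keeps the leaf from being isolated, so the turn is kept only if this was the last
    string, which scores the centre. *)
Lemma worth_string_full S i : i \in full S ->
  worth star_value S (inl i) =
    let a := #|full S|.-1 in let b := #|strung S| in let c := #|looped S|.+1 in
    (if (a + b == 0)%N then 1 + leaf_value a b c else - leaf_value a b c)%R.
Proof.
move=> iF; have [aE bE cE] := cards_string_full iF.
move: iF; rewrite inE => /andP[lS rS].
rewrite /worth card_newly_isolated_string // rS /= addn0 /star_value bE cE aE /=.
by case: (_ == 0) => //=; rewrite add0r.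
Qed.

(** The leaf always scores, so the turn never passes; the boolean adds the centre when the last
    string goes. *)
Lemma worth_string_strung S i : i \in strung S ->
  worth star_value S (inl i) =
    let a := #|full S| in let b := #|strung S|.-1 in let c := #|looped S| in
    ((a + b == 0)%N.+1%:Z + leaf_value a b c)%R.
Proof.
move=> iF; have [aE bE cE] := cards_string_strung iF.
move: iF; rewrite inE => /andP[lS rS].
by rewrite /worth card_newly_isolated_string // rS /= addn1 /star_value bE cE aE.
Qed.

Lemma worth_loop_full S i : i \in full S ->
  worth star_value S (inr i) =
    (- leaf_value #|full S|.-1 #|strung S|.+1 #|looped S|)%R.
Proof.
move=> iF; have [aE bE cE] := cards_loop_full iF.
move: iF; rewrite inE => /andP[lS rS].
by rewrite /worth card_newly_isolated_loop // lS /= /star_value bE cE aE add0r.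
Qed.

Lemma worth_loop_looped S i : i \in looped S ->
  worth star_value S (inr i) =
    (1 + leaf_value #|full S| #|strung S| #|looped S|.-1)%R.
Proof.
move=> iF; have [aE bE cE] := cards_loop_looped iF.
move: iF; rewrite inE => /andP[lS rS].
by rewrite /worth card_newly_isolated_loop // lS /= /star_value bE cE aE.
Qed.

(** The constants come from positions with [a] full leaves only. For [a = 1], cutting the string
    scores the centre and then the loop scores the leaf: [2]. For larger [a], cutting a string hands
    over one looped leaf, so the value satisfies [t(a) = -(1 + t(a-1))] and alternates between [2]
    and [-3]. *)
Lemma star_value_minimax : minimax_value star_value.
Proof.
split=> [|S e eS|S Sn0].
- rewrite /star_value.
  have -> : full set0 = set0 by apply/setP=> i; rewrite !inE.
  have -> : strung set0 = set0 by apply/setP=> i; rewrite !inE.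
  have -> : looped set0 = set0 by apply/setP=> i; rewrite !inE.
  by rewrite cards0.
- case: e eS => i iS.
    case rS: (inr i \in S).
      have iF : i \in full S by rewrite inE iS rS.
      rewrite worth_string_full // /star_value /leaf_value /=.
      have : 0 < #|full S| by apply/card_gt0P; exists i.
      by case: #|full S| => // a _ /=; do ![case: ifP => /= ?]; lia.
    have iF : i \in strung S by rewrite inE iS rS.
    rewrite worth_string_strung // /star_value /leaf_value /=.
    have : 0 < #|strung S| by apply/card_gt0P; exists i.
    by do ![case: ifP => /= ?]; lia.
  case lS: (inl i \in S).
    have iF : i \in full S by rewrite inE iS lS.
    rewrite worth_loop_full // /star_value /leaf_value /=.
    have : 0 < #|full S| by apply/card_gt0P; exists i.
    by do ![case: ifP => /= ?]; lia.
  have iF : i \in looped S by rewrite inE iS lS.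
  rewrite worth_loop_looped // /star_value /leaf_value /=.
  have : 0 < #|looped S| by apply/card_gt0P; exists i.
  by do ![case: ifP => /= ?]; lia.
(* Attainment: scoring moves come first, so a full leaf is opened only when no strung or looped leaf
   is left. *)
- have [c0|[i iF]] := set_0Vmem (looped S); last first.
    exists (inr i); first by move: iF; rewrite inE => /andP[].
    rewrite worth_loop_looped // /star_value /leaf_value.
    have : 0 < #|looped S| by apply/card_gt0P; exists i.
    by do ![case: ifP => /= ?]; lia.
  have [b0|[i iF]] := set_0Vmem (strung S); last first.
    exists (inl i); first by move: iF; rewrite inE => /andP[].
    rewrite worth_string_strung // /star_value /leaf_value.
    have : 0 < #|strung S| by apply/card_gt0P; exists i.
    by do ![case: ifP => /= ?]; lia.
  have [a0|[i iF]] := set_0Vmem (full S); last first.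
    exists (inl i); first by move: iF; rewrite inE => /andP[].
    rewrite worth_string_full // /star_value /leaf_value /= b0 c0 cards0.
    have : 0 < #|full S| by apply/card_gt0P; exists i.
    by do ![case: ifP => /= ?]; lia.
  (* Any remaining edge makes its leaf full, strung or looped, so the three classes cannot all be
     empty. *)
  case/set0Pn: Sn0 => -[i|i] iS; move/setP/(_ i): a0.
    by move/setP/(_ i): b0; rewrite !inE iS /=; case: (_ \in _).
  by move/setP/(_ i): c0; rewrite !inE iS andbT /= andbT; case: (_ \in _).
Qed.

Lemma star_value_setT : star_value setT = leaf_value m 0 0.
Proof.
rewrite /star_value.
have -> : full setT = setT by apply/setP=> i; rewrite !inE.
have -> : strung setT = set0 by apply/setP=> i; rewrite !inE.
have -> : looped setT = set0 by apply/setP=> i; rewrite !inE.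
by rewrite cardsT card_ord cards0.
Qed.

End LoopyStar.

Theorem theorem3 (m : nat) (hm : 1 <= m) :
  (~~ odd (m + 1) -> wins_by (loopy_star m) Player1 2) /\
  (odd (m + 1) -> wins_by (loopy_star m) Player2 3).
Proof.
have [opt_ex opt_margin] := minimax_value_optimal
  (p := start (loopy_star m)) (star_value_minimax m) erefl.
(* Play starts at score [(0, 0)], so Player 1's final margin is [leaf_value m 0 0]: [2] for odd [m],
   [-3] for even [m]; [hm] excludes the branch [m = 0], of value [0]. *)
by split=> odd_m; split=> // r /opt_margin;
  rewrite star_value_setT /leaf_value /margin /=; do ![case: ifP => /= ?]; lia.
Qed.
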